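(* For every $\gamma>0$ there exists a constant $C>0$ such that the following holds. Let $M$ be an $n\times n$ Boolean matrix with $\gamma_2(M)\leq \gamma$, and let $t$ be a positive integer. If $M$ has at least $Ctn$ one-entries, then $M$ contains a $t\times t$ all-ones submatrix.
   Context: A Boolean matrix has entries in $\{0,1\}$; a submatrix is obtained by selecting any subset of rows and any subset of columns. For a real matrix $M$, $\gamma_2(M)=\min_{U,V:\,M=UV}\|U\|_{\mathrm{row}}\|V\|_{\mathrm{col}}$, where $\|U\|_{\mathrm{row}}$ is the maximum Euclidean norm of a row of $U$ and $\|V\|_{\mathrm{col}}$ is the maximum Euclidean norm of a column of $V$. *)

(* Defs.v *)
From HB Require Import structures.
From mathcomp Require Import all_boot all_order all_algebra.
From mathcomp Require Import classical_sets reals.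

Set Implicit Arguments.
Unset Strict Implicit.
Unset Printing Implicit Defensive.

Import Order.TTheory GRing.Theory Num.Theory.
Local Open Scope ring_scope.
Local Open Scope classical_set_scope.

Definition eucl_norm (R : realType) (k : nat) (u : 'rV[R]_k) : R :=
  Num.sqrt (\sum_(j < k) u 0 j ^+ 2).

(* The default value 0 of the maximum only matters for a matrix without rows,
   as Euclidean norms are nonnegative. *)
Definition row_norm (R : realType) (m k : nat) (U : 'M[R]_(m, k)) : R :=
  \big[Num.max/0]_(i < m) eucl_norm (row i U).

Definition col_norm (R : realType) (k n : nat) (V : 'M[R]_(k, n)) : R :=
  \big[Num.max/0]_(j < n) eucl_norm (col j V)^T.

(* The inner dimension k of the factorization is arbitrary. *)
Definition gamma2_values (R : realType) (m n : nat) (M : 'M[R]_(m, n)) :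
    set R :=
  [set x | exists (k : nat) (U : 'M[R]_(m, k)) (V : 'M[R]_(k, n)),
             M = U *m V /\ x = row_norm U * col_norm V].

(* The infimum is a minimum by compactness, the inner dimension being
   reducible to at most m + n; gamma2_has_inf rules out the junk value
   of inf. *)
Definition gamma2 (R : realType) (m n : nat) (M : 'M[R]_(m, n)) : R :=
  inf (gamma2_values M).

Lemma row_norm_ge0 (R : realType) (m k : nat) (U : 'M[R]_(m, k)) :
  0 <= row_norm U.
Proof.
rewrite /row_norm; elim/big_ind: _ => // [x y x0 y0|i _].
  by rewrite le_max x0.
exact: sqrtr_ge0.
Qed.

Lemma col_norm_ge0 (R : realType) (k n : nat) (V : 'M[R]_(k, n)) :
  0 <= col_norm V.
Proof.
rewrite /col_norm; elim/big_ind: _ => // [x y x0 y0|i _].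
  by rewrite le_max x0.
exact: sqrtr_ge0.
Qed.

Lemma gamma2_has_inf (R : realType) (m n : nat) (M : 'M[R]_(m, n)) :
  has_inf (gamma2_values M).
Proof.
split.
  exists (row_norm M * col_norm (1%:M : 'M[R]_n)).
  by exists n, M, 1%:M; rewrite mulmx1.
exists 0 => _ [k [U [V [_ ->]]]].
by rewrite mulr_ge0 ?row_norm_ge0 ?col_norm_ge0.
Qed.

Definition boolean_mx (R : realType) (m n : nat) (M : 'M[R]_(m, n)) : Prop :=
  forall i j, M i j = 0 \/ M i j = 1.

Definition one_entries (R : realType) (m n : nat) (M : 'M[R]_(m, n)) :
    {set 'I_m * 'I_n} :=
  [set p | M p.1 p.2 == 1]%SET.

Definition has_all_ones_submx (R : realType) (m n : nat) (s t : nat)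
    (M : 'M[R]_(m, n)) : Prop :=
  exists (I : {set 'I_m}) (J : {set 'I_n}),
    [/\ #|I| = s, #|J| = t &
        forall i j, i \in I -> j \in J -> M i j = 1].

(* Main.v *)
(** Write the matrix as E i j = <u_i, v_j> with |u_i|^2 <= a and |v_j|^2 <= b, and
    call two rows correlated when <u_i, u_i'> >= 1/(2b).  Pairwise uncorrelated
    rows all joined to j satisfy |X| = <sum u_x, v_j>, so Cauchy-Schwarz bounds
    their number by k = 2ab.  Hence, if Z is a maximal uncorrelated set of rows
    ("leaders"), every column is joined to at most k leaders, while every row i
    is correlated with a leader z(i).  For a random half Y of Z, restrict to the
    rows led by Y and the columns joined to no member of Y: subtracting from
    u_i its projection on u_{z(i)} does not change the matrix there, and it
    shortens u_i by a fixed amount.  A pair (i, j) with E (z i) j = 0 survives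
    with probability at least 2^-(k+1), so this step can be iterated.

    If all rows are sparse, most pairs survive and the iteration ends with a zero
    rectangle of linear size.  In general, choose leaders of smallest degree
    first.  Either a fixed fraction of the ones survives, and one iterates, or
    most ones (i, j) satisfy E (z i) j = 1; then most rows i have almost all their
    ones inside N(z(i)), which is not larger than N(i), and averaging over the
    leaders gives an almost full rectangle of both dimensions of order
    e(E)/(|R|+|T|).  Its complement is sparse and is again a matrix of bounded
    gamma_2, so the first case yields the all-ones submatrix. *)

Require Import Defs.
From HB Require Import structures.
From mathcomp Require Import all_boot all_order all_algebra.
From mathcomp Require Import classical_sets reals.
(* Imported again because [classical_sets] shadows [subsetP] and others. *)
From mathcomp Require Import fintype finset zify ring lra.

Import Order.TTheory GRing.Theory Num.Theory.
Local Open Scope ring_scope.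

Set Implicit Arguments.
Unset Strict Implicit.
Unset Printing Implicit Defensive.

(** * Edge counts, and the random and greedy choice of leaders *)

Section Counting.
Local Open Scope nat_scope.
Variables (I J : finType).
Implicit Types (E P : I -> J -> bool) (R A Z : {set I}) (T B : {set J}).

Definition nbhd E T (i : I) : {set J} := [set j in T | E i j].

Definition edges E R T : nat := \sum_(i in R) #|nbhd E T i|.

Lemma edgesE E R T : edges E R T = \sum_(i in R) \sum_(j in T) E i j.
Proof.
apply: eq_bigr => i _; rewrite -sum1_card big_mkcond [RHS]big_mkcond /=.
by apply: eq_bigr => j _; rewrite inE; case: (j \in T); case: (E i j).
Qed.

Lemma edges_le_mul E R T : edges E R T <= #|R| * #|T|.
Proof.
rewrite -sum_nat_const; apply: leq_sum => i _.
by apply: subset_leq_card; apply/subsetP => j; rewrite inE => /andP[].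
Qed.

Lemma card_nbhdC E T i :
  #|nbhd E T i| + #|nbhd (fun i j => ~~ E i j) T i| = #|T|.
Proof.
rewrite -(cardsID [set j | E i j] T); congr (_ + _); apply: eq_card => j.
  by rewrite !inE.
by rewrite !inE andbC.
Qed.

(** Adding [x] to the subsets of [Z :\: X :\ x] is injective and gives only separating sets; this
    difference misses at most [k.+1] elements of [Z]. *)
Lemma card_subsets_separating {Z X : {set I}} {x : I} {k : nat} :
  x \in Z -> x \notin X -> #|X| <= k ->
  2 ^ #|Z| <= 2 ^ k.+1 * #|[set Y in powerset Z | (x \in Y) && [disjoint Y & X]]|.
Proof.
move=> xZ xX Xk.
set W := Z :\: X :\ x.
have ZW : #|Z| <= k.+1 + #|W|.
  have := cardsD1 x (Z :\: X); rewrite -/W !inE xX xZ /=.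
  have := cardsID X Z; have := subset_leq_card (subsetIr Z X); lia.
have le_pow : 2 ^ #|W| <= #|[set Y in powerset Z | (x \in Y) && [disjoint Y & X]]|.
  rewrite -card_powerset -(card_in_imset (f := fun Y => x |: Y)); last first.
    move=> Y Y'; rewrite !inE => /subsetP sY /subsetP sY' /setP eY.
    apply/setP => y; have := eY y; rewrite !inE; case: eqP => //= ->.
    have: x \notin Y by apply/negP => /sY; rewrite !inE eqxx.
    have: x \notin Y' by apply/negP => /sY'; rewrite !inE eqxx.
    by move=> /negbTE-> /negbTE->.
  apply: subset_leq_card; apply/subsetP => V /imsetP[Y]; rewrite !inE => /subsetP sY ->.
  rewrite !inE eqxx /=; apply/andP; split.
    apply/subsetP => y; rewrite !inE => /orP[/eqP->//|/sY].
    by rewrite !inE => /and3P[].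
  rewrite disjoint_subset; apply/subsetP => y; rewrite !inE.
  by move=> /orP[/eqP->//|/sY]; rewrite !inE => /and3P[].
apply: leq_trans (_ : 2 ^ (k.+1 + #|W|) <= _); first by rewrite leq_exp2l.
by rewrite expnD leq_mul2l le_pow orbT.
Qed.

(* A uniformly random subset Y of Z contains the leader [z i] and misses the
   at most k leaders joined to j with probability at least 2^-(k+1). *)
Lemma random_leaders {E P R T Z} {z : I -> I} {k : nat} :
  {in R, forall i, z i \in Z} ->
  {in T, forall j, #|[set x in Z | E x j]| <= k} ->
  {in R & T, forall i j, P i j -> ~~ E (z i) j} ->
  exists2 Y : {set I}, Y \subset Z &
    edges P R T <= 2 ^ k.+1 *
      edges P [set i in R | z i \in Y] [set j in T | [forall x in Y, ~~ E x j]].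
Proof.
move=> zZ degk Pz.
pose R' (Y : {set I}) := [set i in R | z i \in Y].
pose T' (Y : {set I}) := [set j in T | [forall x in Y, ~~ E x j]].
pose good i j := [set Y in powerset Z | (z i \in Y) && [disjoint Y & [set x in Z | E x j]]].
(* The expected number of surviving pairs, multiplied by the number of subsets and computed pair by
   pair. *)
have sumE : \sum_(Y in powerset Z) edges P (R' Y) (T' Y) =
    \sum_(i in R) \sum_(j in T) P i j * #|good i j|.
  have step (Y : {set I}) : Y \in powerset Z -> edges P (R' Y) (T' Y) =
      \sum_(i in R) \sum_(j in T) P i j * (Y \in good i j).
    rewrite inE => sYZ; rewrite edgesE /R' /T'.
    rewrite (eq_bigl (fun i => (i \in R) && (z i \in Y))); last by move=> i; rewrite inE.
    rewrite big_mkcondr; apply: eq_bigr => i iR.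
    case: ifP => zY; last first.
      by rewrite big1 // => j _; rewrite !inE zY andbF muln0.
    rewrite (eq_bigl (fun j => (j \in T) && [forall x in Y, ~~ E x j])); last first.
      by move=> j; rewrite inE.
    rewrite big_mkcondr; apply: eq_bigr => j jT; rewrite !inE sYZ zY /=.
    have -> : [disjoint Y & [set x in Z | E x j]] = [forall x in Y, ~~ E x j].
      apply/idP/forall_inP => [dY x xY|H].
        have := disjointFr dY xY; rewrite inE (subsetP sYZ) //= => ->.
        by [].
      rewrite disjoint_subset; apply/subsetP => x xY.
      by rewrite !inE negb_and H // orbT.
    by case: ifP; rewrite ?muln1 ?muln0.
  rewrite (eq_bigr _ step) exchange_big; apply: eq_bigr => i iR.
  rewrite exchange_big; apply: eq_bigr => j jT.
  rewrite -big_distrr /=; congr (_ * _).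
  rewrite -sum1_card big_mkcond [RHS]big_mkcond; apply: eq_bigr => Y _.
  by rewrite !inE; case: (Y \subset Z) => //=; case: ifP.
have sum_ge : 2 ^ #|Z| * edges P R T <=
    2 ^ k.+1 * \sum_(Y in powerset Z) edges P (R' Y) (T' Y).
  rewrite sumE edgesE !big_distrr; apply: leq_sum => i iR.
  rewrite !big_distrr; apply: leq_sum => j jT /=.
  case Pij: (P i j); rewrite ?mul0n ?muln0 // mul1n muln1.
  apply: card_subsets_separating; rewrite ?zZ ?degk //.
  by rewrite inE negb_and Pz ?orbT.
have [/exists_inP[Y]|/exists_inPn noY] :=
    boolP [exists Y in powerset Z, edges P R T <= 2 ^ k.+1 * edges P (R' Y) (T' Y)].
  by rewrite inE => sY leY; exists Y.
(* If every [Y] failed, each strict inequality would gain 1, and the total gain [2 ^ #|Z|]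
   contradicts [sum_ge]. *)
have : \sum_(Y in powerset Z) (2 ^ k.+1 * edges P (R' Y) (T' Y)).+1 <=
    \sum_(Y in powerset Z) edges P R T.
  by apply: leq_sum => Y YZ; rewrite ltnNge noY.
rewrite sum_nat_const card_powerset; under eq_bigr => Y _ do rewrite -addn1.
rewrite big_split -big_distrr /= sum1_card card_powerset => H.
have := leq_trans H sum_ge; rewrite -[X in _ <= X]addn0 leq_add2l leqNgt expn_gt0.
by [].
Qed.

End Counting.

(** Take an element with least [f] as a leader, discard it with all its [H]-neighbours, and repeat.
    Minimality at the time of choice gives [f x <= f i]. *)
Lemma greedy_leaders {I : finType} (f : I -> nat) (H : rel I) (R : {set I}) :
  symmetric H ->
  exists Z : {set I}, [/\ Z \subset R,
    {in Z &, forall x y, x != y -> ~~ H x y} &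
    {in R, forall i, exists2 x, x \in Z & (f x <= f i)%N /\ (i = x \/ H i x)}].
Proof.
move=> symH; move: {2}#|R|.+1 (ltnSn #|R|) => N.
elim: N R => // N IH R ltRN.
have [->|[i0' i0'R]] := set_0Vmem R.
  exists set0; split; first by rewrite sub0set.
    by move=> x y; rewrite inE.
  by move=> x; rewrite inE.
have [i0 i0R fmin] := arg_minnP f i0'R.
have {}i0R : i0 \in R := i0R.
pose R1 := [set i in R | (i != i0) && ~~ H i i0].
have sR1 : R1 \subset R :\ i0.
  by apply/subsetP => i; rewrite !inE => /and3P[-> ->].
have [|Z [sZ indZ capZ]] := IH R1.
  have := subset_leq_card sR1; have := cardsD1 i0 R; rewrite i0R; lia.
exists (i0 |: Z); split.
- apply/subsetP => i; rewrite !inE => /orP[/eqP->//|/(subsetP sZ)].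
  by rewrite inE => /andP[].
- move=> x y; rewrite !inE => /orP[/eqP->|xZ] /orP[/eqP->|yZ] nxy.
  + by rewrite eqxx in nxy.
  + by have := subsetP sZ _ yZ; rewrite inE symH => /and3P[].
  + by have := subsetP sZ _ xZ; rewrite inE => /and3P[].
  + exact: indZ.
- move=> i iR; have [->|nii0] := eqVneq i i0.
    by exists i0; rewrite ?setU11 //; split; [|left].
  case Hi: (H i i0).
    by exists i0; rewrite ?setU11 //; split; [exact: fmin|right].
  have [|x xZ capx] := capZ i; first by rewrite inE iR nii0 Hi.
  by exists x => //; rewrite setU1r.
Qed.

(** * Dot products: Cauchy-Schwarz and orthogonal projection *)

Section Dot.
Variables (F : realFieldType) (d : nat).
Implicit Types (x y z : 'rV[F]_d).

Definition dot x y : F := \sum_k x 0 k * y 0 k.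

Lemma dotC x y : dot x y = dot y x.
Proof. by apply: eq_bigr => k _; rewrite mulrC. Qed.

Lemma dotBl x y z : dot (x - y) z = dot x z - dot y z.
Proof. by rewrite -sumrB; apply: eq_bigr => k _; rewrite !mxE mulrBl. Qed.

Lemma dotZl c x y : dot (c *: x) y = c * dot x y.
Proof. by rewrite mulr_sumr; apply: eq_bigr => k _; rewrite !mxE mulrA. Qed.

Lemma dot_suml (I : finType) (A : {set I}) (u : I -> 'rV[F]_d) y :
  dot (\sum_(i in A) u i) y = \sum_(i in A) dot (u i) y.
Proof.
rewrite exchange_big; apply: eq_bigr => k _.
by rewrite summxE mulr_suml.
Qed.

Lemma dot_ge0 x : 0 <= dot x x.
Proof. by apply: sumr_ge0 => k _; rewrite -expr2 sqr_ge0. Qed.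

Lemma dot_eq0 x : (dot x x == 0) = (x == 0).
Proof.
apply/eqP/eqP => [|->]; last by rewrite /dot big1 // => k _; rewrite mxE mul0r.
move=> /psumr_eq0P x0; apply/rowP => k; rewrite mxE.
by apply/eqP; rewrite -sqrf_eq0 expr2 x0 // => j _; rewrite -expr2 sqr_ge0.
Qed.

Lemma dot0l y : dot 0 y = 0.
Proof. by rewrite -(scale0r 0) dotZl mul0r. Qed.

Lemma dot_sub_sub c t x y :
  dot (c *: x - t *: y) (c *: x - t *: y) =
  c ^+ 2 * dot x x - c * t * dot x y *+ 2 + t ^+ 2 * dot y y.
Proof.
rewrite dotBl !dotZl (dotC x) (dotC y) !dotBl !dotZl (dotC y x).
ring.
Qed.

(** Expand the squared norm of [b *: x - dot x y *: y]; using [b] instead of [dot y y] avoids the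
    case [y = 0]. *)
Lemma sqr_dot_le {x y} {b : F} :
  0 < b -> dot y y <= b -> dot x y ^+ 2 <= b * dot x x.
Proof.
move=> b0 yb; have := dot_ge0 (b *: x - dot x y *: y).
rewrite dot_sub_sub; set s := dot x y; set X := dot x x => ge0.
rewrite -(ler_pM2l b0) -subr_ge0; apply: le_trans ge0 _.
have : s ^+ 2 * dot y y <= s ^+ 2 * b by rewrite ler_wpM2l ?sqr_ge0.
nra.
Qed.

(** By Pythagoras, the projection removes exactly [dot x y ^+ 2 / dot y y] from the squared norm. *)
Lemma dot_proj_le {x y} {a kappa : F} :
  0 < kappa -> kappa <= dot x y -> 0 < a -> dot y y <= a ->
  dot (x - (dot x y / dot y y) *: y) (x - (dot x y / dot y y) *: y) <=
  dot x x - kappa ^+ 2 / a.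
Proof.
move=> k0 kxy a0 ya.
have y0 : 0 < dot y y.
  rewrite lt0r dot_ge0 andbT dot_eq0; apply/eqP => y0.
  by move: kxy; rewrite y0 dotC dot0l leNgt k0.
set t := _ / _.
have -> : dot (x - t *: y) (x - t *: y) = dot x x - dot x y ^+ 2 / dot y y.
  by rewrite -[x in LHS]scale1r dot_sub_sub /t; field; rewrite gt_eqF.
rewrite lerD2l lerN2 ler_pdivrMr // mulrAC ler_pdivlMr //.
have s0 := lt_le_trans k0 kxy.
by rewrite ler_pM ?sqr_ge0 ?dot_ge0 ?ler_sqr ?nnegrE ?(ltW k0) ?(ltW s0).
Qed.

End Dot.

(** * Iterated projection: empty and almost full rectangles *)

Section Structure.
Variables (F : realFieldType) (I J : finType) (a b : F) (k : nat).
Hypotheses (a_gt0 : 0 < a) (b_gt0 : 0 < b) (abk : 2 * (a * b) <= k%:R).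
Implicit Types (E P : I -> J -> bool) (R A Z : {set I}) (T B : {set J}).

Let kappa : F := (2 * b)^-1.
Let eps : F := kappa ^+ 2 / a.

Let kappa_gt0 : 0 < kappa.
Proof. by rewrite invr_gt0 mulr_gt0. Qed.

(* [eps] is the decrease of |u_i|^2 under projection, so [l] bounds the number of
   iterations. *)
Definition factors (l : nat) E R T : Prop :=
  exists (d : nat) (u : I -> 'rV[F]_d) (v : J -> 'rV[F]_d),
    [/\ {in R & T, forall i j, dot (u i) (v j) = (E i j)%:R},
        {in R, forall i, dot (u i) (u i) <= a},
        {in R, forall i, dot (u i) (u i) <= l%:R * eps} &
        {in T, forall j, dot (v j) (v j) <= b}].

Lemma factors0 {E R T} : factors 0 E R T -> {in R & T, forall i j, ~~ E i j}.
Proof.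
move=> [d [u [v [uvE _ u0 _]]]] i j iR jT.
have := u0 i iR; rewrite mul0r => ui0.
have /eqP : dot (u i) (u i) == 0 by rewrite eq_le ui0 dot_ge0.
move/eqP; rewrite dot_eq0 => /eqP ui.
have := uvE i j iR jT; rewrite ui dot0l.
by case: (E i j) => // /eqP; rewrite eq_sym oner_eq0.
Qed.

(** Cauchy-Schwarz gives |X|^2 <= b |X| (a + |X| kappa). Since b kappa = 1/2, the quadratic term on
    the right is half of the left side, which leaves |X| <= 2ab. *)
Lemma card_independent_le {d : nat} {u : I -> 'rV[F]_d} {v : 'rV[F]_d}
    {X : {set I}} :
  {in X, forall i, dot (u i) v = 1} -> dot v v <= b ->
  {in X, forall i, dot (u i) (u i) <= a} ->
  {in X &, forall x y, x != y -> dot (u x) (u y) < kappa} ->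
  (#|X| <= k)%N.
Proof.
move=> Xv vb Xa indX; have := @sqr_dot_le _ _ (\sum_(x in X) u x) v b b_gt0 vb.
rewrite dot_suml (eq_bigr (fun=> 1)) // sumr_const dot_suml => sq.
have le_norm : \sum_(i in X) dot (u i) (\sum_(x in X) u x) <=
    #|X|%:R * (a + #|X|%:R * kappa).
  rewrite mulr_natl -sumr_const; apply: ler_sum => i iX.
  rewrite dotC dot_suml (bigD1 i) //= lerD ?Xa //.
  rewrite mulr_natl -sumr_const big_mkcondr /=; apply: ler_sum => j jX.
  by case: eqP => [_|/eqP ji] /=; [exact: ltW|apply/ltW/indX].
have : #|X|%:R ^+ 2 <= b * (#|X|%:R * (a + #|X|%:R * kappa)).
  by apply: le_trans sq _; rewrite ler_pM2l.
have [->//|X0] := posnP #|X|; move=> H.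
have X0' : 0 < #|X|%:R :> F by rewrite ltr0n.
rewrite -(ler_nat F); apply: le_trans abk.
rewrite -(ler_pM2l X0').
have bk : b * kappa = 2^-1 by rewrite /kappa; field; rewrite gt_eqF.
have : b * (#|X|%:R * (a + #|X|%:R * kappa)) =
    #|X|%:R * (a * b) + #|X|%:R ^+ 2 * (b * kappa) by ring.
by rewrite bk => e; rewrite e in H; lra.
Qed.

(** One step of the iteration. [P] is quantified after [z] because both applications build [P] from
    [z]; [f] sets the order in which leaders are chosen. *)
Lemma leaders {l : nat} {E R T} (f : I -> nat) : factors l.+1 E R T ->
  exists (Z : {set I}) (z : I -> I), [/\ Z \subset R, {in R, forall i, z i \in Z},
    {in R, forall i, (f (z i) <= f i)%N},
    {in T, forall j, (#|[set x in Z | E x j]| <= k)%N} &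
    forall P, {in R & T, forall i j, P i j -> ~~ E (z i) j} ->
      exists R' T', [/\ R' \subset R, T' \subset T, factors l E R' T' &
        (edges P R T <= 2 ^ k.+1 * edges P R' T')%N]].
Proof.
move=> [d [u [v [uvE ua ul vb]]]].
pose H x y := kappa <= dot (u x) (u y).
have symH : symmetric H by move=> x y; rewrite /H dotC.
have [Z [ZR indZ capZ]] := greedy_leaders f R symH.
pose leads i x := [&& x \in Z, (f x <= f i)%N & (i == x) || H i x].
(* The default [i] never occurs for [i \in R], where a leader exists. *)
pose z i := odflt i [pick x | leads i x].
have zP i : i \in R -> leads i (z i).
  move=> iR; rewrite /z; case: pickP => [x//|no].
  have [x xZ [fx cx]] := capZ i iR; have /negP[] := negbT (no x).
  by rewrite /leads xZ fx /=; case: cx => [->|->]; rewrite ?eqxx ?orbT.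
have degk : {in T, forall j, (#|[set x in Z | E x j]| <= k)%N}.
  move=> j jT; apply: (@card_independent_le d u (v j)).
  - by move=> i; rewrite inE => /andP[/(subsetP ZR) iR Eij]; rewrite uvE ?Eij.
  - exact: vb.
  - by move=> i; rewrite inE => /andP[/(subsetP ZR) /ua].
  - move=> x y; rewrite !inE => /andP[xZ _] /andP[yZ _] nxy.
    by rewrite ltNge; exact: indZ.
have zZ : {in R, forall i, z i \in Z} by move=> i /zP /and3P[].
exists Z, z; split => //; first by move=> i /zP /and3P[].
move=> P Pz; have [Y YZ le] := random_leaders zZ degk Pz.
set R' := [set i in R | _] in le; set T' := [set j in T | _] in le.
exists R', T'; split => //; try by apply/subsetP => i; rewrite inE => /andP[].
pose w i := u i - (dot (u i) (u (z i)) / dot (u (z i)) (u (z i))) *: u (z i).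
have eps_ge0 : 0 <= eps by rewrite divr_ge0 ?sqr_ge0 // ltW.
(* A row leading itself may have squared norm below [kappa], so the decrease by [eps] can fail; its
   projection is 0 instead. *)
have w_le i : i \in R ->
    dot (w i) (w i) <= dot (u i) (u i) - eps \/ dot (w i) (w i) = 0.
  move=> iR; have /and3P[/(subsetP ZR) zR _] := zP i iR.
  case: eqVneq => [ezi _|_ /=].
    right; rewrite /w -ezi; have [->|ui] := eqVneq (u i) 0.
      by rewrite scaler0 subr0 dot0l.
    by rewrite divff ?dot_eq0 // scale1r subrr dot0l.
  by move=> kz; left; apply: dot_proj_le => //; exact: ua.
exists d, w, v; split.
- move=> i j; rewrite !inE => /andP[iR zY] /andP[jT /forall_inP noE].
  have zR := subsetP ZR _ (zZ i iR).
  by rewrite dotBl dotZl !uvE // (negbTE (noE _ zY)) mulr0 subr0.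
- move=> i; rewrite inE => /andP[iR _].
  case: (w_le i iR) => [wi|->]; last exact: ltW.
  by apply: le_trans wi (le_trans _ (ua i iR)); rewrite gerBl.
- move=> i; rewrite inE => /andP[iR _].
  case: (w_le i iR) => [wi|->]; last by rewrite mulr_ge0.
  by apply: le_trans wi _; rewrite lerBlDr -[X in _ + X]mul1r -mulrDl natr1 ul.
- by move=> j; rewrite inE => /andP[/vb].
Qed.

(** Each step costs a factor [2 ^ k.+2]: [2 ^ k.+1] for survival, and 2 because only half of the
    pairs need be zeros of the leader's row. *)
Lemma empty_rectangle {l : nat} {E R T} : factors l E R T ->
  {in R, forall i, (2 * (2 ^ k.+2) ^ l * #|nbhd E T i| <= #|T|)%N} ->
  exists A B, [/\ A \subset R, B \subset T, (#|R| <= (2 ^ k.+2) ^ l * #|A|)%N,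
    (#|T| <= (2 ^ k.+2) ^ l * #|B|)%N & {in A & B, forall i j, ~~ E i j}].
Proof.
elim: l R T => [|l IH] R T fE sparse.
  by exists R, T; split; rewrite ?expn0 ?mul1n //; exact: factors0.
have q_gt0 n : (0 < (2 ^ k.+2) ^ n)%N by rewrite !expn_gt0.
have [R0|R_gt0] := posnP #|R|.
  exists R, T; split; rewrite ?leq_pmull //.
  by move=> i j; rewrite (cards0_eq R0) inE.
have [T0|T_gt0] := posnP #|T|.
  exists R, T; split; rewrite ?leq_pmull //.
  by move=> i j _; rewrite (cards0_eq T0) inE.
have [Z [z [ZR zZ _ _ dec]]] := leaders (fun=> 0%N) fE.
have [|R' [T' [sR sT fE' le]]] := dec (fun i j => ~~ E (z i) j); first by [].
(* The leader [z i] is itself a sparse row of [R], so it misses at least half of [T]. *)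
have half : (#|R| * #|T| <= 2 * edges (fun i j => ~~ E (z i) j) R T)%N.
  rewrite -sum_nat_const big_distrr; apply: leq_sum => i iR /=.
  have := sparse (z i) (subsetP ZR _ (zZ i iR)).
  have := card_nbhdC (fun i => E (z i)) T i.
  rewrite /nbhd; have := q_gt0 l.+1; nia.
have RT : (#|R| * #|T| <= 2 ^ k.+2 * (#|R'| * #|T'|))%N.
  apply: leq_trans half _; rewrite [(2 ^ k.+2)%N]expnS -mulnA leq_mul2l /=.
  by apply: leq_trans le _; rewrite leq_mul2l edges_le_mul orbT.
have R'le : (#|R| <= 2 ^ k.+2 * #|R'|)%N.
  rewrite -(leq_pmul2r T_gt0) (leq_trans RT) // mulnA leq_mul2l.
  by rewrite subset_leq_card ?orbT.
have T'le : (#|T| <= 2 ^ k.+2 * #|T'|)%N.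
  rewrite -(leq_pmul2l R_gt0) (leq_trans RT) // mulnCA leq_mul2r.
  by rewrite subset_leq_card ?orbT.
have [i iR'|A [B [sA sB cA cB AB]]] := IH R' T' fE'.
  (* The columns shrink by at most [2 ^ k.+2], exactly the factor by which the sparsity requirement
     weakens from [l.+1] to [l]. *)
  rewrite -(leq_pmul2l (q_gt0 1%N)) expn1 (leq_trans _ T'le) //.
  apply: leq_trans (sparse i (subsetP sR _ iR')).
  rewrite mulnA mulnCA -expnS leq_mul2l; apply/orP; right.
  apply: subset_leq_card; apply/subsetP => j; rewrite !inE.
  by move=> /andP[/(subsetP sT)-> ->].
exists A, B; split => //; rewrite ?(subset_trans sA) ?(subset_trans sB) //.
  by rewrite expnS -mulnA (leq_trans R'le) // leq_mul2l cA orbT.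
by rewrite expnS -mulnA (leq_trans T'le) // leq_mul2l cB orbT.
Qed.

(** In [Q], the term [2 * s.+1 * 2 ^ k.+1] pays for an iteration when [bad] ones are frequent;
    [2 * k + 3] exceeds the loss [2 * k.+1] of the final averaging. *)
Lemma dense_rectangle {s l : nat} {E R T} (Q := (2 * s.+1 * 2 ^ k.+1 + 2 * k + 3)%N) :
  (1 < s)%N -> factors l E R T -> (0 < edges E R T)%N ->
  exists A B, [/\ A \subset R, B \subset T,
    (edges E R T <= Q ^ l * #|A| * (#|R| + #|T|))%N,
    (edges E R T <= Q ^ l * #|B| * (#|R| + #|T|))%N &
    {in A, forall i, (s * #|nbhd (fun i j => ~~ E i j) B i| <= 2 * #|B|)%N}].
Proof.
move=> s_gt1; elim: l R T => [|l IH] R T fE e_gt0.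
  move: e_gt0; rewrite edgesE big1 // => i iR; rewrite big1 // => j jT.
  by rewrite (negbTE (factors0 fE iR jT)).
have [Z [z [ZR zZ deg_z degk dec]]] := leaders (fun i => #|nbhd E T i|) fE.
pose bad i j := E i j && ~~ E (z i) j.
have [few|many] := leqP (edges E R T) (2 * s.+1 * edges bad R T).
  have [|R' [T' [sR sT fE' le]]] := dec bad; first by move=> i j _ _ /andP[].
  have le' : (edges bad R' T' <= edges E R' T')%N.
    apply: leq_sum => i _; apply: subset_leq_card.
    by apply/subsetP => j; rewrite !inE => /and3P[-> ->].
  have eR'T' : (edges E R T <= Q * edges E R' T')%N.
    apply: leq_trans few _; rewrite /Q; have := leq_mul (leqnn (2 * s.+1)) le.
    rewrite mulnA; have := leq_mul (leqnn (2 * s.+1 * 2 ^ k.+1)) le'; lia.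
  have [|A [B [sA sB eA eB AB]]] := IH R' T' fE'.
    by move: (leq_trans e_gt0 eR'T'); rewrite muln_gt0 => /andP[].
  have RT : (#|R'| + #|T'| <= #|R| + #|T|)%N.
    by rewrite leq_add ?subset_leq_card.
  exists A, B; split; rewrite ?(subset_trans sA) ?(subset_trans sB) //.
    apply: leq_trans eR'T' _; rewrite expnS -!mulnA leq_mul2l; apply/orP; right.
    by apply: leq_trans eA _; rewrite -mulnA leq_mul2l leq_mul2l RT !orbT.
  apply: leq_trans eR'T' _; rewrite expnS -!mulnA leq_mul2l; apply/orP; right.
  by apply: leq_trans eB _; rewrite -mulnA leq_mul2l leq_mul2l RT !orbT.
pose common i x := #|nbhd E T i :&: nbhd E T x|.
have degE i : #|nbhd E T i| = (common i (z i) + #|nbhd bad T i|)%N.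
  rewrite -(cardsID (nbhd E T (z i))); congr (_ + _)%N; apply: eq_card => j.
  by rewrite !inE /bad; case: (j \in T); case: (E i j); case: (E (z i) j).
pose good i := (s * #|nbhd bad T i| <= #|nbhd E T i|)%N.
pose A x := [set i in R | good i && (z i == x)].
(* A row that is not [good] has fewer than [s] times its [bad] ones, so all such rows together, with
   the [bad] ones of good rows, account for less than half of the edges. *)
have e_le : (edges E R T <= 2 * \sum_(i in R | good i) common i (z i))%N.
  have : (edges E R T <= \sum_(i in R | good i) common i (z i) + s.+1 * edges bad R T)%N.
    rewrite big_distrr big_mkcondr -big_split; apply: leq_sum => i iR /=.
    by case: ifPn => [_|]; rewrite /good degE; lia.
  by move: many; lia.
have sumA : (\sum_(i in R | good i) common i (z i) <= \sum_(x in Z) #|A x| * #|nbhd E T x|)%N.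
  rewrite (partition_big z (mem Z)) /=; last by move=> i /andP[/zZ].
  apply: leq_sum => x _; rewrite -sum_nat_const.
  rewrite (eq_bigl (mem (A x))); last by move=> i; rewrite /= inE andbA.
  apply: leq_sum => i; rewrite !inE => /and3P[_ _ /eqP->].
  by apply: subset_leq_card; exact: subsetIr.
have cardA : (\sum_(x in Z) #|A x| <= #|R|)%N.
  rewrite -[X in (_ <= X)%N]sum1_card [X in (_ <= X)%N](partition_big z (mem Z)) //=.
  apply: leq_sum => x _; rewrite -sum1_card big_mkcond [X in (_ <= X)%N]big_mkcond /=.
  by apply: leq_sum => i _; rewrite !inE; case: (i \in R); case: (good i).
have cardB : (\sum_(x in Z) #|nbhd E T x| <= k * #|T|)%N.
  have -> : (\sum_(x in Z) #|nbhd E T x| = \sum_(j in T) #|[set x in Z | E x j]|)%N.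
    rewrite -/(edges E Z T) edgesE exchange_big; apply: eq_bigr => j _.
    rewrite -sum1_card big_mkcond [RHS]big_mkcond /=; apply: eq_bigr => x _.
    by rewrite inE; case: (x \in Z); case: (E x j).
  rewrite mulnC -sum_nat_const; exact: leq_sum.
set S := (#|R| + #|T|)%N.
have K_gt : (2 * k + 3 <= Q ^ l.+1)%N.
  by rewrite expnS (@leq_trans Q) ?leq_pmulr ?expn_gt0 /Q; lia.
have [/exists_inP[x xZ /andP[eA eB]]|/exists_inPn none] :=
    boolP [exists x in Z, (edges E R T <= Q ^ l.+1 * #|A x| * S)%N &&
                          (edges E R T <= Q ^ l.+1 * #|nbhd E T x| * S)%N].
  exists (A x), (nbhd E T x); split => //.
  - by apply/subsetP => i; rewrite inE => /andP[].
  - by apply/subsetP => j; rewrite inE => /andP[].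
  move=> i; rewrite !inE => /and3P[iR gi /eqP zi].
  (* As |N(x)| <= |N(i)|, row [i] misses at most its number of [bad] ones, say m, inside N(x). From
     s m <= common + m and s >= 2 follows m <= common, hence s m <= 2 common <= 2 |N(x)|. *)
  have := card_nbhdC E (nbhd E T x) i.
  have -> : nbhd E (nbhd E T x) i = nbhd E T i :&: nbhd E T x.
    by apply/setP => j; rewrite !inE; case: (j \in T); rewrite ?andbF //= andbC.
  have := deg_z i iR; move: gi; rewrite /good degE zi -/(common i x).
  have : (common i x <= #|nbhd E T x|)%N by exact: subset_leq_card (subsetIr _ _).
  nia.
(* For each leader one of the two sides is below e / (Q^(l+1) S), which bounds the product of the
   sides by that ratio times their sum. *)
have sum_none : (Q ^ l.+1 * S * \sum_(x in Z) #|A x| * #|nbhd E T x| <=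
    edges E R T * (#|R| + k * #|T|))%N.
  apply: (@leq_trans (edges E R T * \sum_(x in Z) (#|A x| + #|nbhd E T x|))); last first.
    by rewrite leq_mul2l big_split leq_add ?orbT.
  rewrite !big_distrr; apply: leq_sum => x xZ /=.
  move: (none x xZ); rewrite negb_and -!ltnNge => /orP[] /ltnW lt.
    by have := leq_mul lt (leqnn #|nbhd E T x|); lia.
  by have := leq_mul lt (leqnn #|A x|); lia.
have S_le : (#|R| + k * #|T| <= k.+1 * S)%N by rewrite /S; lia.
have S_gt0 : (0 < S)%N.
  by have := edges_le_mul E R T; rewrite /S; move: e_gt0; nia.
have := leq_trans (leq_mul (leqnn (Q ^ l.+1 * S)) (leq_trans e_le (leq_mul (leqnn 2) sumA))).
move/(_ (2 * (edges E R T * (k.+1 * S)))%N); rewrite mulnCA leq_mul2l /=.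
rewrite (leq_trans sum_none) ?leq_mul2l ?S_le ?orbT // => /(_ isT).
have -> : (2 * (edges E R T * (k.+1 * S)) = (2 * k.+1) * (S * edges E R T))%N by lia.
rewrite -mulnA leq_pmul2r ?muln_gt0 ?S_gt0 //; lia.
Qed.

End Structure.

(** The decrease per step is 1/(4ab^2), so [a] amounts to 4(ab)^2 steps, at most [l] of them. *)
Lemma factors_of_le (F : realFieldType) (I J : finType) (a b h : F) (l d : nat)
    (E : I -> J -> bool) (R : {set I}) (T : {set J}) (u : I -> 'rV[F]_d) (v : J -> 'rV[F]_d) :
  0 < a -> 0 < b -> a * b <= h -> 4 * h ^+ 2 <= l%:R ->
  {in R & T, forall i j, dot (u i) (v j) = (E i j)%:R} ->
  {in R, forall i, dot (u i) (u i) <= a} -> {in T, forall j, dot (v j) (v j) <= b} ->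
  factors a b l E R T.
Proof.
move=> a0 b0 abh hl uvE ua vb; exists d, u, v; split => // i iR.
apply: le_trans (ua i iR) _.
have -> : (2 * b)^-1 ^+ 2 / a = (4 * a * b ^+ 2)^-1.
  by field; rewrite !gt_eqF.
rewrite ler_pdivlMr ?mulr_gt0 ?exprn_gt0 //; apply: le_trans hl.
have -> : a * (4 * a * b ^+ 2) = 4 * (a * b) ^+ 2 by ring.
have ab0 : 0 < a * b by rewrite mulr_gt0.
by rewrite ler_wpM2l // ler_sqr // nnegrE ltW // (lt_le_trans ab0).
Qed.

(** * Matrix factorizations as dot products of bounded vectors *)

Section EuclideanNorm.
Variable R : realType.

Lemma eucl_norm_sqr (k : nat) (u : 'rV[R]_k) : eucl_norm u ^+ 2 = dot u u.
Proof.
rewrite /eucl_norm sqr_sqrtr; last by apply: sumr_ge0 => j _; rewrite sqr_ge0.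
by apply: eq_bigr => j _; rewrite expr2.
Qed.

Lemma dot_row_le (m k : nat) (U : 'M[R]_(m, k)) (i : 'I_m) :
  dot (row i U) (row i U) <= row_norm U ^+ 2.
Proof.
rewrite -eucl_norm_sqr ler_sqr ?nnegrE ?row_norm_ge0 ?sqrtr_ge0 //.
exact: (le_bigmax _ (fun i => eucl_norm (row i U))).
Qed.

Lemma dot_col_le (k n : nat) (V : 'M[R]_(k, n)) (j : 'I_n) :
  dot (col j V)^T (col j V)^T <= col_norm V ^+ 2.
Proof.
rewrite -eucl_norm_sqr ler_sqr ?nnegrE ?col_norm_ge0 ?sqrtr_ge0 //.
exact: (le_bigmax _ (fun j => eucl_norm (col j V)^T)).
Qed.

Lemma dot_row_col (m k n : nat) (U : 'M[R]_(m, k)) (V : 'M[R]_(k, n)) i j :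
  dot (row i U) (col j V)^T = (U *m V) i j.
Proof. by rewrite mxE; apply: eq_bigr => l _; rewrite !mxE. Qed.

End EuclideanNorm.

Lemma dot_row_mx (F : realFieldType) (d e : nat) (x x' : 'rV[F]_d) (y y' : 'rV[F]_e) :
  dot (row_mx x y) (row_mx x' y') = dot x x' + dot y y'.
Proof.
rewrite /dot big_split_ord; congr (_ + _); apply: eq_bigr => i _.
  by rewrite !row_mxEl.
by rewrite !row_mxEr.
Qed.

Lemma dot_scalar (F : realFieldType) (c c' : F) : dot c%:M c'%:M = c * c'.
Proof. by rewrite /dot big_ord1 !mxE !mulr1n. Qed.

Lemma subset_of_card (T : finType) (A : {set T}) (t : nat) :
  (t <= #|A|)%N -> exists2 B : {set T}, B \subset A & #|B| = t.
Proof.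
move=> /card_geqP[s [us szs sA]]; exists [set x in s].
  by apply/subsetP => x; rewrite inE => /sA.
by rewrite cardsE (card_uniqP us).
Qed.

(** * Choice of constants and assembly *)

Unset Implicit Arguments.

Theorem theorem1p6 (R : realType) (gamma : R) (hgamma : 0 < gamma) :
  exists C : R, 0 < C /\
    forall (n : nat) (M : 'M[R]_n) (t : nat),
      (0 < n)%N -> boolean_mx M -> gamma2 M <= gamma -> (0 < t)%N ->
      C * t%:R * n%:R <= #|one_entries M|%:R ->
      has_all_ones_submx t t M.
Proof.
(* Bounds the product of squared norms both for the matrix, at most (gamma + 1)^2 for a
   factorization within 1 of the infimum, and for its complement, at most 2 + 2 (gamma + 1)^2. *)
pose h : R := 2 + 2 * (gamma + 1) ^+ 2.
have h_gt0 : 0 < h by rewrite ltr_wpDr // mulr_ge0 ?sqr_ge0.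
pose k := Num.bound (2 * h); pose l := Num.bound (4 * h ^+ 2).
have hk : 2 * h <= k%:R by apply/ltW/archi_boundP; rewrite mulr_ge0 // ltW.
have hl : 4 * h ^+ 2 <= l%:R by apply/ltW/archi_boundP; rewrite mulr_ge0 ?sqr_ge0.
(* [q] and [K] are kept opaque, lest conversion evaluate the powers in unary. *)
have [q qE] : exists q, q = ((2 ^ k.+2) ^ l)%N by eexists.
have [K KE] : exists K, K = ((2 * (2 * (2 * q)).+1 * 2 ^ k.+1 + 2 * k + 3) ^ l)%N by eexists.
have q_gt0 : (0 < q)%N by rewrite qE !expn_gt0.
have K_gt0 : (0 < K)%N by rewrite KE expn_gt0 addn_gt0 orbT.
(* [K] is lost in the almost full rectangle, [q] in the empty one of its complement, and 2 comes
   from [n + n]. *)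
exists (2 * K * q)%:R; split; first by rewrite ltr0n !muln_gt0 K_gt0.
move=> n M t n_gt0 boolM gM t_gt0.
pose E i j := M i j == 1.
have ME i j : M i j = (E i j)%:R.
  by rewrite /E; case: (boolM i j) => ->; rewrite ?eqxx // eq_sym oner_eq0.
have -> : #|one_entries M| = edges E setT setT.
  rewrite edgesE pair_big /= -sum1_card big_mkcond [RHS]big_mkcond /=.
  by apply: eq_bigr => p _; rewrite !inE /E; case: eqP.
rewrite -!natrM ler_nat => many.
have e_gt0 : (0 < edges E setT setT)%N.
  by apply: leq_trans many; rewrite !muln_gt0 K_gt0 q_gt0 t_gt0.
have [x [d [U [V [MUV ->]]]] xlt] := inf_adherent ltr01 (gamma2_has_inf M).
pose u i := row i U; pose v j := (col j V)^T.
have uvE i j : dot (u i) (v j) = (E i j)%:R by rewrite dot_row_col -MUV ME.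
set a := row_norm U in xlt; set b := col_norm V in xlt.
(* A single one-entry forces both norms to be positive. *)
have [i0 [j0 E00]] : exists i j, E i j.
  have [/existsP[i /existsP[j Eij]]|] := boolP [exists i, exists j, E i j].
    by exists i, j.
  move=> noE; move: e_gt0; rewrite edgesE big1 // => i _; rewrite big1 // => j _.
  move: noE; rewrite negb_exists => /forallP/(_ i).
  by rewrite negb_exists => /forallP/(_ j)/negbTE->.
have a_gt0 : 0 < a.
  rewrite lt0r row_norm_ge0 andbT; apply/eqP => a0.
  have := dot_row_le U i0; rewrite -/a a0 expr0n /= => ui0.
  have := uvE i0 j0; rewrite E00 /u.
  have -> : row i0 U = 0 by apply/eqP; rewrite -dot_eq0 eq_le ui0 dot_ge0.
  by rewrite dot0l => /eqP; rewrite eq_sym oner_eq0.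
have b_gt0 : 0 < b.
  rewrite lt0r col_norm_ge0 andbT; apply/eqP => b0.
  have := dot_col_le V j0; rewrite -/b b0 expr0n /= => vj0.
  have := uvE i0 j0; rewrite E00 /v.
  have -> : (col j0 V)^T = 0 by apply/eqP; rewrite -dot_eq0 eq_le vj0 dot_ge0.
  by rewrite dotC dot0l => /eqP; rewrite eq_sym oner_eq0.
have ab_le : a ^+ 2 * b ^+ 2 <= (gamma + 1) ^+ 2.
  rewrite -exprMn ler_sqr ?nnegrE ?mulr_ge0 ?addr_ge0 ?ltW //.
  by apply: lt_le_trans xlt _; rewrite lerD2r.
have fE : factors (a ^+ 2) (b ^+ 2) l E setT setT.
  apply: (@factors_of_le _ _ _ _ _ h _ _ _ _ _ u v); rewrite ?exprn_gt0 //.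
  - by rewrite /h; have := sqr_ge0 (gamma + 1); lra.
  - by move=> i _; exact: dot_row_le.
  - by move=> j _; exact: dot_col_le.
(* With s = 4q, the bound s m <= 2 |B| on the zeros of a row becomes 2q m <= |B|, the sparsity that
   [empty_rectangle] asks of the complement. *)
have [] // := dense_rectangle (s := (2 * (2 * q))%N) (k := k) _ _ _ _ fE e_gt0; rewrite ?exprn_gt0 //.
- by rewrite /h in hk; have := sqr_ge0 (gamma + 1); lra.
- by rewrite (@leq_trans (2 * (2 * 1))%N) // !leq_mul2l.
move=> A [B [_ _ eA eB AB]].
rewrite -KE !cardsT card_ord in eA eB.
have a2 : 0 < 2 * a ^+ 2 by rewrite mulr_gt0 ?exprn_gt0.
have b2 : 0 < a ^- 2 + b ^+ 2 by rewrite addr_gt0 ?invr_gt0 ?exprn_gt0.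
have ab2E : 2 * a ^+ 2 * (a ^- 2 + b ^+ 2) = 2 + 2 * (a ^+ 2 * b ^+ 2).
  by field; rewrite gt_eqF.
(* The complement is represented by the vectors (a, -u i) and (1/a, v j). *)
have fE' : factors (2 * a ^+ 2) (a ^- 2 + b ^+ 2) l (fun i j => ~~ E i j) A B.
  apply: (@factors_of_le _ _ _ _ _ h _ _ _ _ _
    (fun i => row_mx a%:M (- u i)) (fun j => row_mx a^-1%:M (v j))).
  - exact: a2.
  - exact: b2.
  - by rewrite ab2E /h; lra.
  - exact: hl.
  - move=> i j _ _; rewrite dot_row_mx dot_scalar divff ?gt_eqF //.
    rewrite -[- u i]sub0r dotBl dot0l uvE.
    by case: (E i j); rewrite /= ?sub0r ?subrr ?subr0 ?addr0.
  - move=> i _; rewrite dot_row_mx dot_scalar -[- u i]sub0r dotBl dot0l dotC dotBl dot0l.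
    by have := dot_row_le U i; rewrite -/a -/(u i); lra.
  - move=> j _; rewrite dot_row_mx dot_scalar -expr2 -exprVn lerD2l.
    exact: dot_col_le.
have ab2 : 2 * (2 * a ^+ 2 * (a ^- 2 + b ^+ 2)) <= k%:R.
  by rewrite ab2E; rewrite /h in hk; lra.
have [|A' [B' [sA sB cA cB AB']]] := empty_rectangle a2 b2 ab2 fE'.
  by move=> i iA; have := AB i iA; rewrite -qE -!mulnA (leq_pmul2l (m := 2)).
rewrite -qE in cA cB.
have large m m' : (edges E setT setT <= K * m * (n + n))%N -> (m <= q * m')%N -> (t <= m')%N.
  move=> em mm'; have := leq_trans many em.
  have -> : (K * m * (n + n) = 2 * K * m * n)%N by clear; lia.
  rewrite leq_pmul2r // -!mulnA !leq_pmul2l // => qt.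
  by have := leq_trans qt mm'; rewrite leq_pmul2l.
have [S SA cardS] := subset_of_card (large _ _ eA cA).
have [T TB cardT] := subset_of_card (large _ _ eB cB).
exists S, T; split => // i j /(subsetP SA) iA' /(subsetP TB) jB'.
by rewrite ME; have := AB' i j iA' jB'; rewrite negbK => ->.
Qed.
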